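(* Let $G$ be a group and $A$ a subset of $G$ containing two distinct elements $x,y$ such that $xyx=yxy$. Then the Dehn quandle $\mathcal{D}(A^G)$ is neither right-orderable nor left-orderable.
   Context: For a group $G$ and a non-empty subset $A\subseteq G$, let $A^G$ be the set of all conjugates in $G$ of elements of $A$. The Dehn quandle $\mathcal{D}(A^G)$ is the set $A^G$ with the operation $x*y=yxy^{-1}$. A quandle $Q$ (with operation $*$) is left-orderable if there is a strict linear order $<$ on $Q$ such that $x<y$ implies $z*x<z*y$ for all $x,y,z\in Q$. It is right-orderable if there is a strict linear order $<'$ on $Q$ such that $x<'y$ implies $x*z<'y*z$ for all $x,y,z\in Q$. *)

(* Defs.v *)
From mathcomp Require Import all_boot.
From mathcomp Require Import boolp classical_sets.

Set Implicit Arguments.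
Unset Strict Implicit.
Unset Printing Implicit Defensive.

Local Open Scope classical_set_scope.
Local Open Scope group_scope.

(* Right-handed convention: the maps x |-> x * y are quandle automorphisms. *)
Record quandle := Quandle {
  quandle_sort :> Type;
  qop : quandle_sort -> quandle_sort -> quandle_sort;
  qop_idem : forall x, qop x x = x;
  qop_bij : forall y, bijective (fun x => qop x y);
  qop_dist : forall x y z, qop (qop x y) z = qop (qop x z) (qop y z)
}.

Definition strict_linear_order (T : Type) (lt : T -> T -> Prop) : Prop :=
  [/\ forall x, ~ lt x x,
      forall x y z, lt x y -> lt y z -> lt x z
    & forall x y, [\/ lt x y, x = y | lt y x]].

Definition left_orderable (Q : quandle) : Prop :=
  exists2 lt : Q -> Q -> Prop, strict_linear_order lt &
    forall x y z : Q, lt x y -> lt (qop z x) (qop z y).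

Definition right_orderable (Q : quandle) : Prop :=
  exists2 lt : Q -> Q -> Prop, strict_linear_order lt &
    forall x y z : Q, lt x y -> lt (qop x z) (qop y z).

Definition conjugates (G : groupType) (A : set G) : set G :=
  [set z | exists2 a, A a & exists g : G, z = g * a * g^-1].

Lemma conjugates_conj (G : groupType) (A : set G) (x g : G) :
  x \in conjugates A -> g * x * g^-1 \in conjugates A.
Proof.
move=> /set_mem[a Aa [h ->]]; apply/mem_set; exists a => //.
by exists (g * h); rewrite invgM !mulgA.
Qed.

Definition dehn_op (G : groupType) (A : set G) (x y : conjugates A) :
    conjugates A :=
  exist _ (val y * val x * (val y)^-1) (conjugates_conj (val y) (valP x)).

Lemma dehn_op_idem (G : groupType) (A : set G) (x : conjugates A) :
  dehn_op x x = x.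
Proof. by apply: val_inj; rewrite /= mulgK. Qed.

Lemma dehn_op_bij (G : groupType) (A : set G) (y : conjugates A) :
  bijective (fun x => dehn_op x y).
Proof.
pose inv (x : conjugates A) : conjugates A :=
  exist _ ((val y)^-1 * val x * (val y)^-1^-1)
          (conjugates_conj (val y)^-1 (valP x)).
exists inv => x; apply: val_inj; rewrite /= invgK !mulgA.
- by rewrite mulVg mul1g mulgVK.
- by rewrite mulgV mul1g mulgK.
Qed.

Lemma dehn_op_dist (G : groupType) (A : set G) (x y z : conjugates A) :
  dehn_op (dehn_op x y) z = dehn_op (dehn_op x z) (dehn_op y z).
Proof. by apply: val_inj; rewrite /= !invgM invgK !mulgA !mulgVK. Qed.

(* The quandle D(A^G); the argument is A rather than A^G. *)
Definition dehn_quandle (G : groupType) (A : set G) : quandle :=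
  Quandle (@dehn_op_idem G A) (@dehn_op_bij G A) (@dehn_op_dist G A).

(* Main.v *)
Require Import Defs.
From mathcomp Require Import all_boot.
From mathcomp Require Import classical_sets.

(** The braid relation xyx = yxy says that conjugating x by y and then by x
    gives y.  So x and y, seen in the quandle, satisfy (x * y) * x = y and,
    exchanging roles, (y * x) * y = x; by self-distributivity this also reads
    x * (y * x) = y and y * (x * y) = x.  In any quandle, two elements bound by
    these identities are incompatible with an invariant order: starting from
    x < y, three translations (by x, y, x), with idempotency used to keep x
    fixed, lead to y < x.  The hypotheses being symmetric in x and y, the case
    y < x is excluded in the same way, so totality forces x = y. *)

(** For elements of a group acting by conjugation, each of the two equations is
    equivalent to the braid relation aba = bab. *)
Definition braided {Q : quandle} (a b : Q) : Prop :=
  qop (qop a b) a = b /\ qop (qop b a) b = a.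

Lemma braidedC {Q : quandle} {a b : Q} : braided a b -> braided b a.
Proof. by case. Qed.

(** As a * a = a, translating the factors of a * b separately by a turns
    (a * b) * a into a * (b * a): this puts the relation in the form suited to
    left translations, which need not be injective. *)
Lemma braided_left {Q : quandle} {a b : Q} :
  braided a b -> qop a (qop b a) = b.
Proof. by case=> + _; rewrite qop_dist qop_idem. Qed.

(** Common end of the two order arguments: since being braided is symmetric,
    it suffices to derive d < c from c < d for one braided pair at a time. *)
Lemma braided_eq_of_reversing {Q : quandle} {lt : Q -> Q -> Prop} {a b : Q} :
  strict_linear_order lt ->
  (forall c d, braided c d -> lt c d -> lt d c) ->
  braided a b -> a = b.
Proof.
case=> irr tr tot rev ab.
have no_lt c d : braided c d -> ~ lt c d.
  by move=> cd lt_cd; apply: (irr c); apply: (tr _ d) => //; apply: rev.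
by case: (tot a b) => // [/(no_lt _ _ ab) | /(no_lt _ _ (braidedC ab))].
Qed.

(** Translating c < d on the right by c, then d, then c gives successively
    c < d * c, then c * d < (d * c) * d = c, then d = (c * d) * c < c. *)
Lemma right_orderable_braided_eq {Q : quandle} {a b : Q} :
  right_orderable Q -> braided a b -> a = b.
Proof.
case=> lt ord mono; apply: (braided_eq_of_reversing ord) => c d [cdc dcd] lt_cd.
case: ord => _ tr _.
have lt_c_dc : lt c (qop d c) by rewrite -[X in lt X _](qop_idem c); apply: mono.
have lt_cd_c : lt (qop c d) c by rewrite -[X in lt _ X]dcd; apply: mono.
by rewrite -[X in lt X _]cdc -[X in lt _ X](qop_idem c); apply: mono.
Qed.

(** The same three translations as for a right order; here they act on the
    second factor, so the identities of [braided_left] replace the defining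
    ones. *)
Lemma left_orderable_braided_eq {Q : quandle} {a b : Q} :
  left_orderable Q -> braided a b -> a = b.
Proof.
case=> lt ord mono; apply: (braided_eq_of_reversing ord) => c d cd lt_cd.
have lt_c_cd : lt c (qop c d) by rewrite -[X in lt X _](qop_idem c); apply: mono.
have lt_dc_c : lt (qop d c) c.
  by rewrite -[X in lt _ X](braided_left (braidedC cd)); apply: mono.
by rewrite -[X in lt X _](braided_left cd) -[X in lt _ X](qop_idem c); apply: mono.
Qed.

Lemma mem_conjugates {G : groupType} {A : set G} {x : G} :
  A x -> x \in conjugates A.
Proof.
by move=> Ax; apply/mem_set; exists x => //; exists 1%g; rewrite mul1g invg1 mulg1.
Qed.

(** Conjugation of x by xy gives y, because (xy)x = y(xy). *)
Lemma braid_conj {G : groupType} {x y : G} :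
  (x * y * x = y * x * y)%g -> (x * (y * x * y^-1) * x^-1 = y)%g.
Proof. by move=> braid; rewrite !mulgA braid !mulgK. Qed.

Lemma dehn_braided {G : groupType} {A : set G} (u v : dehn_quandle A) :
  (val u * val v * val u = val v * val u * val v)%g -> braided u v.
Proof.
by move=> braid; split; apply: val_inj => /=; apply: braid_conj.
Qed.

Theorem proposition4p1 (G : groupType) (A : set G) (x y : G)
    (Ax : A x) (Ay : A y) (neq_xy : x <> y)
    (braid : (x * y * x = y * x * y)%g) :
  ~ right_orderable (dehn_quandle A) /\ ~ left_orderable (dehn_quandle A).
Proof.
pose u : dehn_quandle A := exist _ x (mem_conjugates Ax).
pose v : dehn_quandle A := exist _ y (mem_conjugates Ay).
have uv : braided u v by apply: dehn_braided.
have neq_uv : u <> v by move=> /(congr1 val).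
split=> ord; apply: neq_uv.
- exact: right_orderable_braided_eq ord uv.
- exact: left_orderable_braided_eq ord uv.
Qed.
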